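(* Consider a network (as described in the context) operated under a $w$-WMW policy, for some fixed $w\in\mathbb{R}_{++}^n$. There exists a constant $C$ (the sensitivity constant, depending only on the network and $w$) such that the following holds. Let $A:\mathbb{Z}_+\to\mathbb{R}_+^n$ be any arrival function and $Q(\cdot)$ a corresponding queue length process under the $w$-WMW policy. Let $\lambda\in\mathbb{R}^n$ with $\lambda\succeq 0$ (componentwise), and let $q(\cdot)$ be a fluid solution (for arrival rate $\lambda$ and weights $w$) with $q(0)=Q(0)$. Then for every $k\in\mathbb{Z}_+$, $$\|Q(k)-q(k)\|_2\le C\left(1+\|\lambda\|+\max_{t<k}\Big\|\sum_{\tau=0}^{t}\big(A(\tau)-\lambda\big)\Big\|_2\right).$$
   Context: A network consists of $n$ queues, a routing matrix $R\in\mathbb{R}^{n\times n}$ with nonnegative entries, and a finite set $\mathcal{S}\subset\mathbb{R}_+^n$ of service vectors. Standing assumption: for every $\mu\in\mathcal{S}$ and every $i\in\{1,\dots,n\}$, the vector obtained from $\mu$ by setting its $i$-th entry to zero also belongs to $\mathcal{S}$. Given an arrival function $A:\mathbb{Z}_+\to\mathbb{R}_+^n$, a queue length process $Q:\mathbb{Z}_+\to\mathbb{R}_+^n$ (with $Q(0)\in\mathbb{R}_+^n$) evolves by $Q(t+1)=Q(t)+A(t)+(R-I)\min(\mu(t),Q(t))$, where $\min$ is componentwise and $\mu(t)\in\mathcal{S}$ is the service vector chosen at time $t$. For $w\in\mathbb{R}_{++}^n$ let $W=\mathrm{diag}(w)$ and $\mathcal{S}_w(x)=\arg\max_{\mu\in\mathcal{S}}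 x^TW(I-R)\mu$. Under the $w$-WMW (weighted max-weight) policy, $\mu(t)$ is an arbitrary element of $\mathcal{S}_w(Q(t))$; the MW policy is the case $w=(1,\dots,1)$. Fluid solution: given $\lambda\in\mathbb{R}_+^n$ and weights $w$, an absolutely continuous $q:\mathbb{R}_+\to\mathbb{R}_+^n$ for which there exist functions $s_\mu:\mathbb{R}_+\to[0,1]$ ($\mu\in\mathcal{S}$) and $y:\mathbb{R}_+\to\mathbb{R}_+^n$ such that for almost every $t$: $\dot q(t)=\lambda+(R-I)\big(\sum_{\mu\in\mathcal{S}}s_\mu(t)\mu-y(t)\big)$; $\sum_{\mu}s_\mu(t)=1$; $y_i(t)\le\sum_\mu s_\mu(t)\mu_i$ for all $i$; if $q_i(t)>0$ then $y_i(t)=0$; and if $\mu\notin\mathcal{S}_w(q(t))$ then $s_\mu(t)=0$. The maximum over $t<k$ is taken over integers $0\le t<k$ (and is $0$ when $k=0$). *)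

(* Defs.v *)
From HB Require Import structures.
From mathcomp Require Import all_boot all_order all_algebra.
From mathcomp Require Import boolp classical_sets reals ereal topology normedtype derive measure lebesgue_measure.
Set Implicit Arguments. Unset Strict Implicit. Unset Printing Implicit Defensive.
Import Order.TTheory GRing.Theory Num.Theory.
Local Open Scope ring_scope.

Section Network.
Variables (R : realType) (n : nat).
(* Vectors in R^n are column vectors 'cV[R]_n; the routing matrix is P : 'M[R]_n;
   the finite set of service vectors is a sequence S (duplicates irrelevant). *)

Definition cmin (u v : 'cV[R]_n) : 'cV[R]_n := \col_i Num.min (u i 0) (v i 0).

Definition norm2 (v : 'cV[R]_n) : R := Num.sqrt (\sum_i (v i 0) ^+ 2).

Definition nonneg_vec (v : 'cV[R]_n) : Prop := forall i, 0 <= v i 0.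

Definition zero_entry (mu : 'cV[R]_n) (i : 'I_n) : 'cV[R]_n :=
  \col_j (if j == i then 0 else mu j 0).

Definition wobj (P : 'M[R]_n) (w x mu : 'cV[R]_n) : R :=
  ((x^T *m diag_mx w^T *m (1%:M - P) *m mu) 0 0).

Definition in_Sw (P : 'M[R]_n) (S : seq 'cV[R]_n) (w x mu : 'cV[R]_n) : Prop :=
  mu \in S /\ forall mu', mu' \in S -> wobj P w x mu' <= wobj P w x mu.

Definition wmw_process (P : 'M[R]_n) (S : seq 'cV[R]_n) (w : 'cV[R]_n)
    (A Q : nat -> 'cV[R]_n) : Prop :=
  nonneg_vec (Q 0%N) /\
  exists mu : nat -> 'cV[R]_n,
    forall t : nat, in_Sw P S w (Q t) (mu t) /\
      Q t.+1 = Q t + A t + (P - 1%:M) *m cmin (mu t) (Q t).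

Definition abs_cont_on (f : R -> R) (lo hi : R) : Prop :=
  forall e : R, 0 < e -> exists2 d : R, 0 < d &
    forall (N : nat) (a b : nat -> R),
      (forall k, (k < N)%N -> lo <= a k /\ a k <= b k /\ b k <= hi) ->
      (forall k, (k.+1 < N)%N -> b k <= a k.+1) ->
      \sum_(k < N) (b k - a k) < d ->
      \sum_(k < N) `|f (b k) - f (a k)| < e.

(* fluid solution for arrival rate lam and weights w; q is only relevant on R_+ *)
Definition fluid_solution (P : 'M[R]_n) (S : seq 'cV[R]_n) (w lam : 'cV[R]_n)
    (q : R -> 'cV[R]_n) : Prop :=
  (forall t, 0 <= t -> nonneg_vec (q t)) /\
  (forall i (T : R), 0 <= T -> abs_cont_on (fun t => q t i 0) 0 T) /\
  exists (s : 'cV[R]_n -> R -> R) (y : R -> 'cV[R]_n),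
    (forall mu t, 0 <= t -> 0 <= s mu t <= 1) /\
    (forall t, 0 <= t -> nonneg_vec (y t)) /\
    {ae (@lebesgue_measure R), forall t : R, 0 <= t ->
      (let smu := \sum_(mu <- undup S) s mu t *: mu in
       (forall i, derivable (fun u => q u i 0) t 1 /\
          is_derive t 1 (fun u => q u i 0)
            ((lam + (P - 1%:M) *m (smu - y t)) i 0)) /\
       \sum_(mu <- undup S) s mu t = 1 /\
       (forall i, y t i 0 <= smu i 0) /\
       (forall i, 0 < q t i 0 -> y t i 0 = 0) /\
       (forall mu, mu \in S -> ~ in_Sw P S w (q t) mu -> s mu t = 0))}.

(* max_{0 <= t < k} || sum_{tau=0}^{t} (A tau - lam) ||_2, equal to 0 if k = 0 *)
Definition max_dev (A : nat -> 'cV[R]_n) (lam : 'cV[R]_n) (k : nat) : R :=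
  \big[Num.max/0]_(t < k) norm2 (\sum_(tau < t.+1) (A tau - lam)).

End Network.

(* Main.v *)
Require Import Defs.
From HB Require Import structures.
From mathcomp Require Import all_boot all_order all_algebra.
From mathcomp Require Import boolp classical_sets reals ereal topology normedtype derive measure lebesgue_measure.
From mathcomp Require Import functions measurable_realfun ring lra.
Import Order.TTheory GRing.Theory Num.Theory.
Import numFieldNormedType.Exports.
Local Open Scope ring_scope.

(** Write [a_mu = (I - P) mu] and use the inner product with weights [w].  Up to
    zeroing entries of service vectors, the fluid moves with velocity
    [lam - u], [u] a convex combination of the [a_mu] optimal at [q], and the
    queue, after subtracting the cumulated fluctuation of the arrivals and
    interpolating linearly, moves with velocity [lam - v], [v] a convex
    combination of the [a_mu] that are [e]-optimal, where [e] is a multiple of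
    the right-hand side of the claim.  Hence the difference [d] of the two
    trajectories has velocity [u - v], and every [p = a_mu - a_nu] occurring in
    [v - u] satisfies [<p, d> >= - e].

    The squared norm of [d] may grow at rate [2 e].  Instead consider
      [V d = max_J (|proj_J d|^2 + c_|J| e^2)],
    the maximum over lists [J] of vectors of the form [a_mu - a_nu], with
    [proj_J] the orthogonal projection onto the complement of [J].  When the
    constants [c_k] grow fast enough, the gradient [2 proj_J d] of a piece active
    at [d] satisfies [<proj_J d, p> >= 0] whenever [<p, d> >= - e]: it is
    orthogonal to the [p] on which [d] is small and has the sign of [<p, d>] on
    the others.  So [V] does not increase along [d], and [|d|^2 <= V d <= V 0],
    which is a constant times [e^2]. *)

(** * Induction along a real interval *)

Section RealInduction.
Variable R : realType.

(** The supremum of the points of [[a, b]] where [P] holds inherits [P] through the left clause; if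
    it lay below [b], the right clause would push it further. *)
Lemma real_induction (a b : R) (P : R -> Prop) :
  a <= b -> P a ->
  (forall t, a <= t <= b -> exists2 d, 0 < d &
    (forall x, a <= x <= t -> t - d < x -> P x -> P t) /\
    (forall y, t <= y <= b -> y < t + d -> P t -> P y)) ->
  P b.
Proof.
move=> ab Pa step.
pose E : set R := [set x | a <= x <= b /\ P x]%classic.
have Ea : E a by split=> //; rewrite lexx ab.
have Eub : has_ubound E by exists b => x [/andP[]].
have Esup : has_sup E by split=> //; exists a.
have as_ : a <= sup E by exact: ub_le_sup.
have sb : sup E <= b by apply: ge_sup; [exists a | move=> x [/andP[]]].
have /step[d d0 [left_ right_]] : a <= sup E <= b by rewrite as_ sb.
have Ps : P (sup E).
  have [x [/andP[ax xb] Px] dx] := sup_adherent d0 Esup.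
  apply: (left_ x) => //; rewrite ax /=.
  by apply: (ub_le_sup Eub); split=> //; apply/andP.
pose y := Num.min b (sup E + d / 2).
have sy : sup E <= y by rewrite /y le_min sb/=; lra.
have yb : y <= b by rewrite /y ge_min lexx.
have Py : P y.
  apply: (right_ y) => //; first by rewrite sy yb.
  by rewrite /y gt_min; apply/orP; right; lra.
have ys : y <= sup E.
  by apply: (ub_le_sup Eub); split=> //; apply/andP; split=> //; exact: le_trans sy.
have [sbe|sb'] := leP b (sup E).
  by have -> : b = sup E by apply/eqP; rewrite eq_le sbe sb.
by move: ys; rewrite /y ge_min leNgt sb'/= => ?; exfalso; lra.
Qed.

End RealInduction.

(** * Absolute continuity and a monotonicity criterion *)

Section AbsoluteContinuity.
Variable R : realType.
Implicit Types (f g : R -> R) (a b : R).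

Lemma abs_cont_onS f a b a' b' :
  a <= a' -> b' <= b -> abs_cont_on f a b -> abs_cont_on f a' b'.
Proof.
move=> aa bb fab e e0; have [d d0 fd] := fab e e0; exists d => // N x y xy.
apply: fd => k kN; have [? [? ?]] := xy k kN.
by split; [lra | split; lra].
Qed.

Lemma abs_cont_on_affineB f a b (p r : R) :
  abs_cont_on f a b -> abs_cont_on (fun t => p + (t - a) * r - f t) a b.
Proof.
move=> fab e e0; have [d d0 fd] := fab (e / 2) ltac:(lra).
have r1 : 0 < `|r| + 1 by have := normr_ge0 r; lra.
exists (Num.min d (e / 2 / (`|r| + 1))).
  by rewrite lt_min d0/= divr_gt0//; lra.
move=> N x y xy xyS; rewrite lt_min => /andP[lxy].
rewrite ltr_pdivlMr// => lxy'.
have /fd := lxy => /(_ xy xyS) fe.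
have len0 : 0 <= \sum_(k < N) (y k - x k).
  by apply: sumr_ge0 => k _; have [_ [? _]] := xy k (ltn_ord k); lra.
apply: (@le_lt_trans _ _ (\sum_(k < N) ((y k - x k) * `|r| + `|f (y k) - f (x k)|))).
  apply: ler_sum => k _; have [_ [xk _]] := xy k (ltn_ord k).
  have -> : p + (y k - a) * r - f (y k) - (p + (x k - a) * r - f (x k)) =
    (y k - x k) * r - (f (y k) - f (x k)) by ring.
  apply: le_trans (ler_normB _ _) _.
  by rewrite normrM (@ger0_norm _ (y k - x k)) ?subr_ge0.
by rewrite big_split/= -mulr_suml; nra.
Qed.

(** Points closer than the [d] belonging to tolerance 1 have values less than 1 apart, so walking
    from [a] in steps of [d / 2] changes [f] by at most the number of steps. *)
Lemma abs_cont_on_bounded f a b : a <= b -> abs_cont_on f a b ->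
  exists B, forall t, a <= t <= b -> `|f t| <= B.
Proof.
move=> ab fab; have [d d0 fd] := fab 1 ltr01.
have close s t : a <= s -> s <= t -> t <= b -> t - s < d -> `|f t - f s| < 1.
  move=> as_ st tb ts; have := fd 1 (fun=> s) (fun=> t).
  by rewrite !big_ord1; apply.
have bnd N t : a <= t <= b -> t - a <= N%:R * (d / 2) -> `|f t - f a| <= N%:R.
  elim: N t => [|N IH] t /andP[at_ tb] tN.
    have -> : t = a by rewrite mul0r in tN; lra.
    by rewrite subrr normr0.
  pose s := Num.max a (t - d / 2).
  have as_ : a <= s by rewrite /s le_max lexx.
  have st : s <= t by rewrite /s ge_max at_/=; lra.
  have ds : t - d / 2 <= s by rewrite /s le_max lexx orbT.
  have ts : t - s < d by lra.
  have {}IH : `|f s - f a| <= N%:R.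
    apply: IH; first by lra.
    rewrite /s; have [_|_] := leP a (t - d / 2); first by rewrite -natr1 mulrDl mul1r in tN; lra.
    by rewrite subrr; apply: mulr_ge0 => //; lra.
  rewrite -natr1; have /ltW := close s t as_ st tb ts.
  have -> : f t - f a = (f s - f a) + (f t - f s) by ring.
  by move=> ?; apply: le_trans (ler_normD _ _) _; lra.
have [N NP] : exists N : nat, b - a <= N%:R * (d / 2).
  have x0 : 0 <= (b - a) / (d / 2) by apply: divr_ge0; lra.
  exists (Num.bound ((b - a) / (d / 2))).
  by rewrite -ler_pdivrMr; [apply: ltW; exact: Num.Theory.archi_boundP | lra].
exists (N%:R + `|f a|) => t /andP[at_ tb].
have -> : f t = (f t - f a) + f a by ring.
apply: le_trans (ler_normD _ _) _; rewrite lerD2r.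
by apply: bnd; [rewrite at_ tb | apply: le_trans NP; lra].
Qed.

Lemma abs_cont_on_dominated (n : nat) (g : 'I_n -> R -> R) f a b (K : R) :
  (forall i, abs_cont_on (g i) a b) ->
  (forall s t, a <= s <= b -> a <= t <= b ->
    `|f s - f t| <= K * \sum_i `|g i s - g i t|) ->
  abs_cont_on f a b.
Proof.
move=> gab fg.
have gsum e : 0 < e -> exists2 d, 0 < d & forall N (x y : nat -> R),
      (forall k, (k < N)%N -> a <= x k /\ x k <= y k /\ y k <= b) ->
      (forall k, (k.+1 < N)%N -> y k <= x k.+1) ->
      \sum_(k < N) (y k - x k) < d ->
      \sum_i \sum_(k < N) `|g i (y k) - g i (x k)| < e.
  elim: n g gab {fg} e => [|m IH] g gab e e0.
    by exists 1 => // N x y _ _ _; rewrite big_ord0.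
  have [d1 d10 gd1] := IH (fun i => g (lift ord0 i)) (fun i => gab _) (e / 2) ltac:(lra).
  have [d2 d20 gd2] := gab ord0 (e / 2) ltac:(lra).
  exists (Num.min d1 d2); first by rewrite lt_min d10.
  move=> N x y xy xyS; rewrite lt_min => /andP[/(gd1 _ _ _ xy xyS) ? /(gd2 _ _ _ xy xyS) ?].
  by rewrite big_ord_recl; lra.
move=> e e0; have K1 : 0 < `|K| + 1 by have := normr_ge0 K; lra.
have [d d0 gd] := gsum (e / (`|K| + 1)) ltac:(by rewrite divr_gt0).
exists d => // N x y xy xyS /(gd _ _ _ xy xyS).
rewrite exchange_big/= ltr_pdivlMr//; apply: le_lt_trans.
rewrite mulrC mulr_sumr; apply: ler_sum => k _.
have [? [? ?]] := xy k (ltn_ord k).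
apply: le_trans (fg _ _ _ _) _; [by lra | by lra |].
by apply: ler_wpM2r; [exact: sumr_ge0 | have := ler_norm K; lra].
Qed.

(* Two-sided form of a nonpositive upper Dini derivative of [f] at [t]. *)
Definition dini_nonpos f (t : R) : Prop := forall e, 0 < e ->
  exists2 d, 0 < d & forall s, `|s - t| < d ->
    (t <= s -> f s - f t <= e * (s - t)) /\ (s <= t -> f t - f s <= e * (t - s)).

(** [O] comes from outer regularity, and [g x] is the measure of its part up to [x]. It serves as a
    budget below [d] for the total length of a chain of intervals inside [O]. *)
Lemma outer_mass (N : set R) (d : R) : (@lebesgue_measure R).-negligible N ->
  0 < d -> exists2 O : set R, open O /\ (N `<=` O)%classic &
    exists g : R -> R, [/\ forall x, 0 <= g x < d &
      forall x y, x <= y -> g x <= g y /\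
        ((forall z, x < z <= y -> O z) -> g x + (y - x) <= g y)].
Proof.
move=> [D [mD D0 ND]] d0.
have Doo : (lebesgue_measure D < +oo)%E by rewrite D0 ltry.
have [U [oU DU muU]] := lebesgue_regularity_outer mD Doo d0.
have mU : measurable U by exact: open_measurable.
have {}muU : (lebesgue_measure U < d%:E)%E.
  apply: le_lt_trans muU.
  have -> : lebesgue_measure U =
      (lebesgue_measure D + lebesgue_measure (U `\` D)%classic)%E.
    by rewrite -measureU ?setDIK ?setDUK//; exact: measurableD.
  by rewrite D0 add0e.
exists U; first by split=> //; exact: subset_trans ND DU.
pose G x := (U `&` `]-oo, x])%classic.
have mG x : measurable (G x) by apply: measurableI => //; exact: measurable_itv.
have GU x : (lebesgue_measure (G x) <= lebesgue_measure U)%E.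
  by apply: le_measure; rewrite ?inE; [exact: mG | exact: mU | exact: subIsetl].
have Gfin x : lebesgue_measure (G x) \is a fin_num.
  by rewrite ge0_fin_numE//; apply: le_lt_trans (GU x) (lt_trans muU (ltry _)).
exists (fun x => fine (lebesgue_measure (G x))); split=> [x|x y xy].
  rewrite fine_ge0//= -lte_fin fineK//; exact: le_lt_trans muU.
split=> [|Oxy].
  apply: fine_le => //; apply: le_measure; rewrite ?inE; [exact: mG | exact: mG |].
  move=> z [Uz /=]; rewrite !in_itv/= => zx.
  by split=> //=; rewrite in_itv/=; exact: le_trans xy.
have GV : (G x `|` `]x, y] `<=` G y)%classic.
  move=> z [[Uz]|] /=; rewrite !in_itv/=.
    by move=> zx; split=> //=; rewrite in_itv/= (le_trans zx).
  by move=> /andP[xz zy]; split=> /=; [apply: Oxy; rewrite xz zy | rewrite in_itv].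
have : (lebesgue_measure (G x) + lebesgue_measure (`]x, y]%classic : set R) <=
    lebesgue_measure (G y))%E.
  rewrite -measureU; [|exact: mG|exact: measurable_itv|].
    apply: le_measure; rewrite ?inE; [|exact: mG|exact: GV].
    by apply: measurableU; [exact: mG | exact: measurable_itv].
  apply/seteqP; split=> // z [[_ /=]]; rewrite !in_itv/= => zx /andP[xz _].
  by move: (lt_le_trans xz zx); rewrite ltxx.
have -> : lebesgue_measure (`]x, y]%classic : set R) = (y - x)%:E.
  rewrite lebesgue_measure_itv/= lte_fin; case: ltP => //= yx.
  by congr (_%:E); lra.
by rewrite -[lebesgue_measure (G x)]fineK// -[lebesgue_measure (G y)]fineK.
Qed.

(* The exceptional null set is covered by an open set [O] of small mass: real
   induction produces a chain of intervals in which steps outside [O] cost at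
   most [eta * length] and steps inside [O] are controlled by absolute
   continuity. *)
Lemma abs_cont_dini_nonincreasing f a b : a <= b -> abs_cont_on f a b ->
  {ae (@lebesgue_measure R), forall t, a <= t <= b -> dini_nonpos f t} ->
  f b <= f a.
Proof.
move=> ab fab aef; rewrite leNgt; apply/negP => fba.
pose e := (f b - f a) / 2; have e0 : 0 < e by rewrite /e; lra.
pose eta := e / (b - a + 1); have eta0 : 0 < eta by rewrite divr_gt0//; lra.
have [d d0 fd] := fab e e0.
have [O [oO NO] [g [g0 gO]]] := outer_mass _ _ aef d0.
(* The intervals [[u k, v k]] record the steps made inside [O]: [g x] bounds their total length, and
   the increments of [f] over them stay unestimated until the end. *)
pose P x := exists N (u v : nat -> R), [/\
  forall k, (k < N)%N -> a <= u k /\ u k <= v k /\ v k <= x,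
  forall k, (k.+1 < N)%N -> v k <= u k.+1,
  \sum_(k < N) (v k - u k) <= g x &
  f x - f a <= eta * (x - a) + \sum_(k < N) `|f (v k) - f (u k)|].
have P_dini x y : P x -> x <= y -> f y - f x <= eta * (y - x) -> P y.
  move=> [N [u [v [uv uvS len fx]]]] xy fxy; exists N, u, v; split=> //.
  - move=> k kN; have [? [? ?]] := uv k kN; split=> //; split=> //; lra.
  - by apply: le_trans len _; have [] := gO x y xy.
  - by nra.
have P_open x y : P x -> a <= x -> x <= y -> (forall z, x <= z <= y -> O z) -> P y.
  move=> [N [u [v [uv uvS len fx]]]] ax xy Oxy.
  exists N.+1, (fun k => if (k < N)%N then u k else x),
    (fun k => if (k < N)%N then v k else y); split.
  - move=> k _; case: ltnP => [kN|_]; last by [].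
    by have [? [? ?]] := uv k kN; split=> //; split=> //; lra.
  - move=> k; rewrite ltnS => kN; rewrite kN; case: ltnP => [/uvS//|_].
    by have [? [? ?]] := uv k kN.
  - rewrite big_ord_recr/= ltnn.
    under eq_bigr => k _ do rewrite ltn_ord.
    have [_ /(_ _) gxy] := gO x y xy.
    apply: le_trans (gxy _); first by rewrite lerD2r.
    by move=> z /andP[xz zy]; apply: Oxy; rewrite (ltW xz) zy.
  - rewrite big_ord_recr/= ltnn.
    under eq_bigr => k _ do rewrite ltn_ord.
    have := ler_norm (f y - f x); have : 0 <= eta * (y - x) by nra.
    by nra.
have : P b.
  apply: (@real_induction _ a b P ab).
    exists 0%N, (fun=> 0), (fun=> 0); split=> //; rewrite !big_ord0.
      by have /andP[] := g0 a.
    by rewrite !subrr mulr0 addr0.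
  move=> t /andP[at_ tb].
  have [Ot|Ot] := pselect (O t).
    have /nbhs_ballP[r r0 rO] : nbhs t O by exact: open_nbhs_nbhs.
    exists r => //; split=> [x /andP[ax xt] tx Px|y /andP[ty yb] yt Pt].
      apply: (P_open x) => // z /andP[xz zt]; apply: rO.
      by rewrite /ball/= ger0_norm; lra.
    apply: (P_open t) => // z /andP[tz zy]; apply: rO.
    by rewrite /ball/= ler0_norm; lra.
  have ft : dini_nonpos f t.
    apply: contrapT => nft; apply: Ot; apply: NO => /= h.
    by apply: nft; apply: h; rewrite at_ tb.
  have [r r0 fr] := ft _ eta0.
  exists r => //; split=> [x /andP[ax xt] tx Px|y /andP[ty yb] yt Pt].
    apply: (P_dini x) => //; have [|_ ->//] := fr x.
    by rewrite ler0_norm; lra.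
  apply: (P_dini t) => //; have [|->//] := fr y.
  by rewrite ger0_norm; lra.
move=> [N [u [v [uv uvS len fx]]]].
have /fd := uv => /(_ uvS) small.
have /andP[_ gb] := g0 b.
have {}small := small (le_lt_trans len gb).
(* Both contributions are at most [e], the second strictly, while [f b - f a] equals [2 * e]. *)
have : eta * (b - a) <= e.
  rewrite /eta mulrAC ler_pdivrMr; nra.
by rewrite /e in small *; lra.
Qed.

End AbsoluteContinuity.

Arguments dini_nonpos {R} f t.

(** * Finite maxima and finite families of lists *)

Section FiniteFamilies.
Variables (R : realType) (T : eqType).
Implicit Types (s : seq T).

Lemma seq_bounded s (f : T -> R) :
  exists2 M, 0 <= M & forall x, x \in s -> f x <= M.
Proof.
elim: s => [|x s [M M0 fM]]; first by exists 0.
exists (M + `|f x|); first by rewrite addr_ge0.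
move=> y; rewrite inE => /predU1P[->|/fM ?]; first by have := ler_norm (f x); lra.
by have := normr_ge0 (f x); lra.
Qed.

(** Assuming that every smaller radius also works lets the minimum over the list be taken. The same
    device yields positive lower bounds for finitely many positive numbers. *)
Lemma seq_common_radius s (P : T -> R -> Prop) :
  (forall x, x \in s -> exists2 d, 0 < d & forall r, 0 < r <= d -> P x r) ->
  exists2 d, 0 < d & forall x, x \in s -> P x d.
Proof.
move=> Ps; suff [d d0 dP] : exists2 d, 0 < d &
    forall x, x \in s -> forall r, 0 < r <= d -> P x r.
  by exists d => // x /dP; apply; rewrite d0 lexx.
elim: s Ps => [|x s IH] Ps; first by exists 1.
have [|d d0 dP] := IH; first by move=> y ys; apply: Ps; rewrite inE ys orbT.
have [d' d'0 d'P] := Ps x (mem_head _ _).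
exists (Num.min d d'); first by rewrite lt_min d0.
move=> y ys r /andP[r0]; rewrite le_min => /andP[rd rd'].
by move: ys; rewrite inE => /predU1P[->|/dP]; [apply: d'P | apply]; rewrite r0.
Qed.

Definition seqmax s (F : T -> R) : R := \big[Num.max/0]_(x <- s) F x.

Lemma le_seqmax s F x : x \in s -> F x <= seqmax s F.
Proof. by move=> xs; apply: (bigmax_sup_seq _ x). Qed.

Lemma seqmax_attained s F : (forall x, x \in s -> 0 <= F x) ->
  forall x0, x0 \in s -> exists2 x, x \in s & seqmax s F = F x.
Proof.
rewrite /seqmax; elim: s => [|x s IH] F0 x0 //= _; rewrite big_cons.
case: s IH F0 => [|y s] IH F0.
  exists x; first exact: mem_head.
  by rewrite big_nil; apply/max_idPl/F0/mem_head.
have [|z zs ->] := IH _ y (mem_head _ _).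
  by move=> z zs; apply: F0; rewrite inE zs orbT.
have [_|_] := leP (F x) (F z).
  by exists z => //; rewrite inE zs orbT.
by exists x => //; exact: mem_head.
Qed.

Fixpoint seqs_upto (D : seq T) (k : nat) : seq (seq T) :=
  if k is k'.+1 then [::] :: [seq p :: J | p <- D, J <- seqs_upto D k']
  else [:: [::]].

Lemma mem_seqs_upto D k J : (size J <= k)%N -> {subset J <= D} ->
  J \in seqs_upto D k.
Proof.
elim: k J => [|k IH] [|p J]//= Jk JD; rewrite inE/=.
apply/allpairsP; exists (p, J); split=> //=; first exact/JD/mem_head.
by apply: IH => // q qJ; apply: JD; rewrite inE qJ orbT.
Qed.

Lemma seqs_upto_sub D k J : J \in seqs_upto D k -> {subset J <= D}.
Proof.
elim: k J => [|k IH] J /=; first by rewrite inE => /eqP->.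
rewrite inE => /predU1P[->//|/allpairsP[[p J'] /= [pD /IH J'D ->]]] q.
by rewrite inE => /predU1P[->//|/J'D].
Qed.

(** A duplicate-free list over [D] has at most [size D] entries, so the length bound loses none of
    them. *)
Definition uniq_seqs D := [seq J <- seqs_upto D (size D) | uniq J].

Lemma mem_uniq_seqs D J :
  J \in uniq_seqs D <-> uniq J /\ {subset J <= D}.
Proof.
rewrite mem_filter; split=> [/andP[uJ /seqs_upto_sub]//|[uJ JD]].
by rewrite uJ mem_seqs_upto// uniq_leq_size.
Qed.

End FiniteFamilies.

Arguments seqmax {R T} s F.
Arguments uniq_seqs {T} D.

(** * Dini derivatives of a finite maximum *)

Lemma is_derive_approx (R : realType) (f : R -> R) (t l : R) :
  is_derive t 1 f l -> forall e, 0 < e -> exists2 d, 0 < d &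
    forall s, `|s - t| < d -> `|f s - f t - l * (s - t)| <= e * `|s - t|.
Proof.
move=> [df dl] e e0.
have : ((fun h : R => h^-1 *: (f (h + t) - f t)) @ 0^' --> l)%classic.
  rewrite -dl; have := df; rewrite /derivable /derive.
  by under eq_fun do rewrite /= /GRing.scale/= mulr1.
move=> /cvgrPdist_le /(_ e e0)[d /= d0 dP]; exists d => // s sd.
have [->|st] := eqVneq s t; first by rewrite !subrr mulr0 subrr !normr0 mulr0.
have st0 : s - t != 0 by rewrite subr_eq0.
have := dP (s - t); rewrite /ball/= sub0r normrN subrK => /(_ sd st0).
rewrite /GRing.scale/= => H.
have -> : f s - f t - l * (s - t) = - ((l - (s - t)^-1 * (f s - f t)) * (s - t)).
  by field.
by rewrite normrN normrM ler_wpM2r.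
Qed.

(** To the right of [t], a maximiser at [u] was either inactive at [t], hence still below the old
    maximum by continuity, or active, hence of nonpositive slope. To the left, a maximiser at [t]
    bounds the maximum at [u] from below. *)
Lemma dini_nonpos_seqmax (R : realType) (T : eqType) (s : seq T)
    (F : T -> R -> R) (l : T -> R) (t : R) :
  (forall x u, x \in s -> 0 <= F x u) ->
  (forall x, x \in s -> is_derive t 1 (F x) (l x)) ->
  (forall x, x \in s -> (forall y, y \in s -> F y t <= F x t) -> l x <= 0) ->
  (exists x, x \in s) ->
  dini_nonpos (fun u => seqmax s (F ^~ u)) t.
Proof.
move=> F0 dF lF [x0 x0s] e e0.
pose V u := seqmax s (F ^~ u).
have VF u x : x \in s -> F x u <= V u by exact: (le_seqmax _ _ _ (F ^~ u)).
have Vat u : exists2 x, x \in s & V u = F x u.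
  by apply: seqmax_attained x0s => x; apply: F0.
have [d d0 dP] : exists2 d, 0 < d & forall x, x \in s -> forall u, `|u - t| < d ->
    `|F x u - F x t - l x * (u - t)| <= e * `|u - t| /\
    (F x t < V t -> F x u <= V t).
  apply: (seq_common_radius _ _ s (fun x d => forall u, `|u - t| < d -> _)) => x xs.
  have [d d0 dP] := is_derive_approx _ _ _ _ (dF x xs) _ e0.
  have [xV|xV] := ltP (F x t) (V t); last first.
    by exists d => // r /andP[_ rd] u ur; split=> //; apply: dP; exact: lt_le_trans rd.
  have le0 : 0 < `|l x| + e by have := normr_ge0 (l x); lra.
  (* Within this radius an inactive [F x], growing at average rate at most the denominator, cannot
     exceed the maximum at [t]. *)
  exists (Num.min d ((V t - F x t) / (`|l x| + e))).
    by rewrite lt_min d0/= divr_gt0// subr_gt0.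
  move=> r /andP[r0]; rewrite le_min ler_pdivlMr// => /andP[rd rV] u ur.
  have uP := dP u (lt_le_trans ur rd); split=> // _.
  have := le_trans (ler_norm _) uP.
  have := ler_norm (l x * (u - t)); rewrite normrM => ? ?.
  have : `|u - t| * (`|l x| + e) <= r * (`|l x| + e).
    by apply: ler_wpM2r; exact: ltW.
  by nra.
exists d => // u ud; split=> [tu|ut].
  have [x xs Vx] := Vat u; have [] := dP x xs u ud; rewrite -/(V u) -/(V t) Vx.
  rewrite (@ger0_norm _ (u - t)) ?subr_ge0// => + xV; have [/xV Fx _|Vxt] := ltP (F x t) (V t).
    have : 0 <= e * (u - t) by rewrite mulr_ge0// ?subr_ge0// ltW.
    by lra.
  have lx : l x <= 0 by apply: lF => // y ys; apply: le_trans Vxt; exact: VF.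
  move=> /(le_trans (ler_norm _)).
  have := VF t x xs; have : l x * (u - t) <= 0 by rewrite mulr_le0_ge0// subr_ge0.
  by lra.
have [x xs Vx] := Vat t; have [] := dP x xs u ud; rewrite -/(V u) -/(V t) Vx.
rewrite (@ler0_norm _ (u - t)) ?subr_le0// => + _.
have lx : l x <= 0 by apply: lF => // y ys; rewrite -Vx; exact: VF.
rewrite ler_norml => /andP[+ _].
have := VF u x xs; have : 0 <= l x * (u - t) by rewrite mulr_le0// subr_le0.
by lra.
Qed.

(** * Weighted inner product and Gram-Schmidt projections *)

Section WeightedInnerProduct.
Variables (R : realType) (n : nat) (w : 'cV[R]_n).
Implicit Types (x y z p d : 'cV[R]_n) (J : seq 'cV[R]_n).

Definition ip x y : R := \sum_i w i 0 * x i 0 * y i 0.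

Lemma ipC x y : ip x y = ip y x.
Proof. by apply: eq_bigr => i _; rewrite mulrAC. Qed.

Lemma ip_linear (a : R) x y z : ip z (a *: x + y) = a * ip z x + ip z y.
Proof.
rewrite /ip mulr_sumr -big_split; apply: eq_bigr => i _; rewrite !mxE/=; ring.
Qed.

Lemma ipDr x y z : ip z (x + y) = ip z x + ip z y.
Proof. by rewrite -[x]scale1r ip_linear mul1r scale1r. Qed.

Lemma ip0r x : ip x 0 = 0.
Proof. by rewrite /ip big1// => i _; rewrite mxE mulr0. Qed.

Lemma ipZr (a : R) x z : ip z (a *: x) = a * ip z x.
Proof. by rewrite -[a *: x]addr0 ip_linear ip0r addr0. Qed.

Lemma ipBr x y z : ip z (x - y) = ip z x - ip z y.
Proof. by rewrite ipDr -scaleN1r ipZr mulN1r. Qed.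

Lemma ipDl x y z : ip (x + y) z = ip x z + ip y z.
Proof. by rewrite !(ipC _ z) ipDr. Qed.

Lemma ipBl x y z : ip (x - y) z = ip x z - ip y z.
Proof. by rewrite !(ipC _ z) ipBr. Qed.

Lemma ipZl (a : R) x z : ip (a *: x) z = a * ip x z.
Proof. by rewrite !(ipC _ z) ipZr. Qed.

Lemma is_derive_ip (x y : R -> 'cV[R]_n) (dx dy : 'cV[R]_n) (t : R) :
  (forall i, is_derive t 1 (fun s => x s i 0) (dx i 0)) ->
  (forall i, is_derive t 1 (fun s => y s i 0) (dy i 0)) ->
  is_derive t 1 (fun s => ip (x s) (y s)) (ip dx (y t) + ip (x t) dy).
Proof.
move=> hx hy.
have -> : (fun s => ip (x s) (y s)) =
    \sum_(i < n) (w i 0 *: ((fun s => x s i 0) * (fun s => y s i 0))).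
  by apply/funext => s; rewrite fct_sumE; apply: eq_bigr => i _; rewrite -mulrA.
rewrite /ip -big_split/=; apply: is_derive_sum => i.
have := is_deriveZ (w i 0) (is_deriveM (hx i) (hy i)).
by move/is_derive_eq; apply; rewrite /GRing.scale/=; ring.
Qed.

Hypothesis w_gt0 : forall i, 0 < w i 0.

Lemma ip_ge0 x : 0 <= ip x x.
Proof.
by apply: sumr_ge0 => i _; rewrite -mulrA mulr_ge0 ?(ltW (w_gt0 i))// -expr2 sqr_ge0.
Qed.

Lemma ip_eq0 x : ip x x = 0 -> x = 0.
Proof.
move=> /eqP; rewrite psumr_eq0; last first.
  by move=> i _; rewrite -mulrA mulr_ge0 ?(ltW (w_gt0 i))// -expr2 sqr_ge0.
move=> /allP x0; apply/matrixP => i j; rewrite ord1 mxE.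
have := x0 i (mem_index_enum _) => /=.
by rewrite -mulrA mulf_eq0 (gt_eqF (w_gt0 i))/= mulf_eq0 orbb => /eqP.
Qed.

Lemma ip_gt0 x : x != 0 -> 0 < ip x x.
Proof. by rewrite lt_def ip_ge0 andbT; apply: contra => /eqP/ip_eq0 ->. Qed.

Lemma ip_cauchy_schwarz x y : ip x y ^+ 2 <= ip x x * ip y y.
Proof.
have [->|y0] := eqVneq y 0; first by rewrite !ip0r mulr0 expr0n.
have yy := ip_gt0 y y0.
have := ip_ge0 (ip y y *: x - ip x y *: y).
rewrite !(ipBl, ipBr, ipZl, ipZr) (ipC y x) => H.
have : 0 <= ip y y * (ip x x * ip y y - ip x y ^+ 2) by nra.
by rewrite pmulr_rge0// subr_ge0.
Qed.

(* Gram-Schmidt: [proj J] is the orthogonal projection onto the complement of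
   the span of [J].  A vector [p] dependent on [J] has [proj J p = 0], and the
   correction term then vanishes since [x / 0 = 0]. *)
Fixpoint proj J x : 'cV[R]_n :=
  if J is p :: J' then
    proj J' x - (ip (proj J' p) x / ip (proj J' p) (proj J' p)) *: proj J' p
  else x.

Lemma proj_linear J (a : R) x y : proj J (a *: x + y) = a *: proj J x + proj J y.
Proof.
elim: J => //= p J ->; rewrite ip_linear mulrDl scalerDl -mulrA -scalerA.
by rewrite scalerBr opprD addrACA.
Qed.

Lemma projD J x y : proj J (x + y) = proj J x + proj J y.
Proof. by rewrite -[x]scale1r proj_linear !scale1r. Qed.

Lemma projB J x y : proj J (x - y) = proj J x - proj J y.
Proof. by rewrite addrC -scaleN1r proj_linear scaleN1r addrC. Qed.

Lemma proj0 J : proj J 0 = 0.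
Proof. by rewrite -[X in proj J X](subrr 0) projB subrr. Qed.

Lemma projZ J (a : R) x : proj J (a *: x) = a *: proj J x.
Proof. by rewrite -[a *: x]addr0 proj_linear proj0 addr0. Qed.

Lemma proj_sym J x y : ip (proj J x) y = ip x (proj J y).
Proof.
elim: J x y => //= p J IH x y; rewrite ipBl ipBr ipZl ipZr IH; congr (_ - _).
rewrite (ipC x); ring.
Qed.

Lemma proj_idem J x : proj J (proj J x) = proj J x.
Proof.
elim: J x => //= p J IH x; set g := proj J p.
have gg : proj J g = g by rewrite IH.
rewrite projB projZ gg IH ipBr ipZr -proj_sym gg.
have [-> | g0] := eqVneq g 0; first by rewrite !scaler0 !subr0.
by rewrite divfK ?gt_eqF ?ip_gt0// subrr mul0r scale0r subr0.
Qed.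

Lemma proj_mem J p : p \in J -> proj J p = 0.
Proof.
elim: J => //= q J IH; rewrite inE => /predU1P[->|/IH pJ].
  have -> : ip (proj J q) q = ip (proj J q) (proj J q).
    by rewrite -[RHS]proj_sym proj_idem.
  have [-> | g0] := eqVneq (proj J q) 0; first by rewrite scaler0 subr0.
  by rewrite divff ?gt_eqF ?ip_gt0// scale1r subrr.
by rewrite proj_sym pJ ip0r mul0r scale0r subr0.
Qed.

Lemma ip_proj_ge0 J x : 0 <= ip (proj J x) x.
Proof. by rewrite -proj_idem proj_sym; exact: ip_ge0. Qed.

Lemma ip_proj_le J x : ip (proj J x) x <= ip x x.
Proof.
have := ip_ge0 (x - proj J x).
rewrite !(ipBl, ipBr) -(proj_sym J (proj J x)) proj_idem (ipC x) => ?; lra.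
Qed.

(** Pythagoras for one more Gram-Schmidt step; it prices the passage from [J] to [p :: J] when
    pieces are compared. *)
Lemma ip_proj_cons J p d : ip (proj (p :: J) d) d =
  ip (proj J d) d - ip (proj J p) d ^+ 2 / ip (proj J p) (proj J p).
Proof. by rewrite /= ipBl ipZl; congr (_ - _); ring. Qed.

Lemma is_derive_proj J (x : R -> 'cV[R]_n) (dx : 'cV[R]_n) (t : R) :
  (forall i, is_derive t 1 (fun s => x s i 0) (dx i 0)) ->
  forall i, is_derive t 1 (fun s => proj J (x s) i 0) (proj J dx i 0).
Proof.
move=> hx; elim: J => //= p J IH i.
set g := proj J p; set c := ip g g.
have -> : (fun s => (proj J (x s) - (ip g (x s) / c) *: g) i 0) =
    (fun s => proj J (x s) i 0) - (g i 0 / c) *: (fun s => ip g (x s)).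
  apply/funext => s; rewrite !mxE/=.
  change (proj J (x s) i 0 - ip g (x s) / c * g i 0 =
    proj J (x s) i 0 - (g i 0 / c) * ip g (x s)); ring.
have cg k : is_derive t 1 (fun s : R => g k 0) ((0 : 'cV[R]_n) k 0).
  by rewrite mxE; exact: is_derive_cst.
have dg := is_derive_ip (fun=> g) x 0 dx t cg hx.
have := is_deriveB (IH i) (is_deriveZ (g i 0 / c) dg).
move/is_derive_eq; apply.
by rewrite !mxE (ipC 0) ip0r add0r /GRing.scale/=; congr (_ - _); ring.
Qed.

(** * The piecewise quadratic potential *)

Variables (D : seq 'cV[R]_n) (delta M : R).
Hypothesis delta_gt0 : 0 < delta.
Hypothesis M_ge0 : 0 <= M.
Hypothesis delta_le : forall J p, J \in uniq_seqs D -> p \in D ->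
  proj J p != 0 -> delta <= ip (proj J p) (proj J p).
Hypothesis le_M : forall p, p \in D -> ip p p <= M.

(** With [c = level (size J)], the increment forces [ip (proj J p) d ^+ 2 >= (3 + 2 * M * c) * e ^+
    2] for active [J] and [p] in [D] with nonzero residual. This beats [(e + r) ^+ 2] for any error
    [r] with [r ^+ 2 <= M * c * e ^+ 2]. *)
Fixpoint level (k : nat) : R :=
  if k is k'.+1 then level k' + (3 + 2 * M * level k') / delta else 0.

Lemma level_ge0 k : 0 <= level k.
Proof.
elim: k => //= k IH; rewrite addr_ge0// divr_ge0 ?ltW//.
by have := mulr_ge0 M_ge0 IH; nra.
Qed.

Definition piece (e : R) J d : R := ip (proj J d) d + level (size J) * e ^+ 2.

Definition potential (e : R) d : R := seqmax (uniq_seqs D) (fun J => piece e J d).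

Lemma nil_uniq_seqs : [::] \in uniq_seqs D.
Proof. by apply/mem_uniq_seqs. Qed.

Lemma piece_ge0 e J d : 0 <= piece e J d.
Proof. by rewrite addr_ge0 ?ip_proj_ge0// mulr_ge0 ?sqr_ge0// level_ge0. Qed.

Lemma potential_attained e d :
  exists2 J, J \in uniq_seqs D & potential e d = piece e J d.
Proof.
apply: seqmax_attained nil_uniq_seqs => J _; exact: piece_ge0.
Qed.

Lemma ip_le_potential e d : ip d d <= potential e d.
Proof.
apply: le_trans (le_seqmax _ _ _ _ _ nil_uniq_seqs).
by rewrite /piece /= mul0r addr0.
Qed.

(* If [J] is active at [d], comparison with [[::]] bounds the distance from
   [d] to the flat orthogonal to [J], while comparison with [p :: J] shows that
   [d] is far from the hyperplane orthogonal to [p] inside that flat.  The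
   levels grow fast enough for the second estimate to decide the sign. *)
Lemma active_piece_monotone e J d p : 0 < e -> J \in uniq_seqs D ->
  (forall J', J' \in uniq_seqs D -> piece e J' d <= piece e J d) ->
  p \in D -> - e <= ip p d -> 0 <= ip (proj J d) p.
Proof.
move=> e0 JD act pD pd; rewrite proj_sym ipC.
have [->|g0] := eqVneq (proj J p) 0; first by rewrite ipC ip0r.
have gg := ip_gt0 _ g0; have dgg := delta_le _ _ JD pD g0.
have pJD : p :: J \in uniq_seqs D.
  move/mem_uniq_seqs: JD => [uJ sJ]; apply/mem_uniq_seqs; split=> /=.
    by rewrite uJ andbT; apply/negP => /proj_mem /eqP; rewrite (negPf g0).
  by move=> q; rewrite inE => /predU1P[->|/sJ].
set x := ip (proj J p) d.
set c := level (size J); have c0 : 0 <= c by exact: level_ge0.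
have far : (3 + 2 * M * c) * e ^+ 2 <= x ^+ 2.
  have := act _ pJD; rewrite /piece ip_proj_cons /= -/c -/x => H.
  have {}H : (3 + 2 * M * c) / delta * e ^+ 2 <= x ^+ 2 / ip (proj J p) (proj J p).
    by lra.
  have H' : x ^+ 2 / ip (proj J p) (proj J p) <= x ^+ 2 / delta.
    by rewrite ler_wpM2l ?sqr_ge0// lef_pV2 ?posrE.
  move: (le_trans H H'); rewrite mulrAC ler_pM2r// invr_gt0//.
have near : ip (d - proj J d) (d - proj J d) <= c * e ^+ 2.
  have := act _ nil_uniq_seqs; rewrite /piece /= mul0r addr0 -/c.
  rewrite !(ipBl, ipBr) -(proj_sym J (proj J d)) proj_idem (ipC d) => ?; lra.
set r := ip p (d - proj J d).
have rP : r ^+ 2 <= M * c * e ^+ 2.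
  apply: le_trans (ip_cauchy_schwarz _ _) _; rewrite -mulrA.
  by apply: ler_pM => //; [exact: ip_ge0|exact: ip_ge0|exact: le_M].
have pdx : ip p d = x + r by rewrite /x proj_sym -ipDr addrC subrK.
rewrite leNgt; apply/negP => x0.
(* If [x < 0], then [x + r >= - e] gives [- x <= e + r], which contradicts [far]. *)
have : x ^+ 2 <= (e + r) ^+ 2.
  by rewrite -sqrrN ler_pXn2r ?nnegrE//; lra.
have : (e + r) ^+ 2 <= 2 * e ^+ 2 + 2 * r ^+ 2 by have := sqr_ge0 (e - r); nra.
have : 0 < e ^+ 2 by rewrite exprn_gt0.
by nra.
Qed.

(** Self-adjointness of [proj J] merges the two terms of the product rule. *)
Lemma is_derive_piece e J (x : R -> 'cV[R]_n) (dx : 'cV[R]_n) (t : R) :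
  (forall i, is_derive t 1 (fun s => x s i 0) (dx i 0)) ->
  is_derive t 1 (fun s => piece e J (x s)) (2 * ip (proj J (x t)) dx).
Proof.
move=> hx; have hp := is_derive_proj J x dx t hx.
have h1 := is_derive_ip _ _ _ _ _ hp hx.
have -> : (fun s => piece e J (x s)) = (fun s => ip (proj J (x s)) (x s)) +
   cst (level (size J) * e ^+ 2) by [].
have := is_deriveD h1 (is_derive_cst (level (size J) * e ^+ 2) t 1).
by move/is_derive_eq; apply; rewrite proj_sym ipC addr0; ring.
Qed.

Lemma dini_nonpos_potential e (x : R -> 'cV[R]_n) (dx : 'cV[R]_n) (t : R) :
  (forall i, is_derive t 1 (fun s => x s i 0) (dx i 0)) ->
  (forall J, J \in uniq_seqs D ->
    (forall J', J' \in uniq_seqs D -> piece e J' (x t) <= piece e J (x t)) ->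
    ip (proj J (x t)) dx <= 0) ->
  dini_nonpos (fun s => potential e (x s)) t.
Proof.
move=> hx act.
apply: (dini_nonpos_seqmax _ _ _ (fun J s => piece e J (x s))
  (fun J => 2 * ip (proj J (x t)) dx)).
- by move=> J u _; exact: piece_ge0.
- by move=> J _; exact: is_derive_piece.
- by move=> J JD /(act J JD); lra.
- by exists [::]; exact: nil_uniq_seqs.
Qed.

Lemma piece_lipschitz e J x y (B : R) :
  (forall i, `|x i 0| <= B) -> (forall i, `|y i 0| <= B) ->
  piece e J x - piece e J y <=
  (\sum_i w i 0 + \sum_i w i 0 * (2 * B) ^+ 2) * \sum_i `|x i 0 - y i 0|.
Proof.
move=> xB yB; set K := (X in X * _).
(* The levels cancel and the difference of the two quadratic forms factors. *)
have -> : piece e J x - piece e J y = ip (proj J (x + y)) (x - y).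
  rewrite /piece projD !(ipDl, ipBr) (proj_sym J y x) (ipC y); ring.
set z := proj J (x + y).
have zz : ip z z <= \sum_i w i 0 * (2 * B) ^+ 2.
  rewrite /z proj_sym proj_idem ipC; apply: le_trans (ip_proj_le _ _) _.
  apply: ler_sum => i _; rewrite -mulrA ler_wpM2l ?(ltW (w_gt0 i))// -expr2.
  rewrite -(real_normK (num_real _)) ler_pXn2r ?nnegrE//.
    rewrite mxE; apply: le_trans (ler_normD _ _) _.
    by have := xB i; have := yB i; lra.
  by have := xB i; have := normr_ge0 (x i 0); lra.
rewrite mulr_sumr; apply: ler_sum => i _.
apply: le_trans (ler_norm _) _; rewrite normrM !mxE ler_wpM2r//.
rewrite normrM (ger0_norm (ltW (w_gt0 i))).
have wi : w i 0 <= \sum_i w i 0.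
  by rewrite (bigD1 i)//= lerDl sumr_ge0// => j _; exact: ltW.
have zi : w i 0 * z i 0 ^+ 2 <= ip z z.
  rewrite /ip (bigD1 i)//= -mulrA -expr2 lerDl sumr_ge0// => j _.
  by rewrite -mulrA mulr_ge0 ?(ltW (w_gt0 j))// -expr2 sqr_ge0.
rewrite /K; apply: (@le_trans _ _ (w i 0 + w i 0 * z i 0 ^+ 2)); last by lra.
rewrite -[X in X + _]mulr1 -mulrDr ler_wpM2l ?(ltW (w_gt0 i))//.
by rewrite -(real_normK (num_real (z i 0))); have := sqr_ge0 (`|z i 0| - 1); have := normr_ge0 (z i 0); nra.
Qed.

Lemma potential_lipschitz e x y (B : R) :
  (forall i, `|x i 0| <= B) -> (forall i, `|y i 0| <= B) ->
  `|potential e x - potential e y| <=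
  (\sum_i w i 0 + \sum_i w i 0 * (2 * B) ^+ 2) * \sum_i `|x i 0 - y i 0|.
Proof.
have half (u v : 'cV[R]_n) : (forall i, `|u i 0| <= B) -> (forall i, `|v i 0| <= B) ->
    potential e u - potential e v <=
    (\sum_i w i 0 + \sum_i w i 0 * (2 * B) ^+ 2) * \sum_i `|u i 0 - v i 0|.
  move=> uB vB; have [J JD ->] := potential_attained e u.
  apply: le_trans (piece_lipschitz e J u v B uB vB); rewrite lerD2l lerN2.
  exact: (le_seqmax _ _ _ (fun J => piece e J v)).
move=> xB yB; rewrite ler_norml half// andbT lerNl opprB.
have -> : \sum_i `|x i 0 - y i 0| = \sum_i `|y i 0 - x i 0|.
  by apply: eq_bigr => i _; rewrite distrC.
exact: half.
Qed.

(** The Lipschitz constant of the potential depends on the size of the coordinates, so the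
    trajectory is first confined to a cube. *)
Lemma abs_cont_on_potential e (x : R -> 'cV[R]_n) a b : a <= b ->
  (forall i, abs_cont_on (fun t => x t i 0) a b) ->
  abs_cont_on (fun t => potential e (x t)) a b.
Proof.
move=> ab xac.
have /choice[B BP] : forall i : 'I_n, exists B, forall t, a <= t <= b -> `|x t i 0| <= B.
  by move=> i; exact: abs_cont_on_bounded.
have [B' _ B'P] := seq_bounded _ _ (enum 'I_n) B.
have xB t i : a <= t <= b -> `|x t i 0| <= B'.
  by move=> /BP /le_trans; apply; apply: B'P; rewrite mem_enum.
apply: (abs_cont_on_dominated _ _ (fun i t => x t i 0)) => // s t sab tab.
by apply: potential_lipschitz => i; exact: xB.
Qed.

End WeightedInnerProduct.

Arguments ip {R n} w x y.
Arguments proj {R n} w J x.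
Arguments level {R} delta M k.
Arguments piece {R n} w delta M e J d.
Arguments potential {R n} w D delta M e d.

(** * The Euclidean norm and its comparison with the weighted one *)

Section EuclideanNorm.
Variables (R : realType) (n : nat).
Implicit Types (u v : 'cV[R]_n) (w : 'cV[R]_n).

Lemma norm2_ge0 v : 0 <= norm2 v.
Proof. exact: sqrtr_ge0. Qed.

Lemma norm2_sqr v : norm2 v ^+ 2 = \sum_i v i 0 ^+ 2.
Proof. by rewrite sqr_sqrtr// sumr_ge0// => i _; exact: sqr_ge0. Qed.

Lemma ip1_norm2 v : ip (const_mx 1) v v = norm2 v ^+ 2.
Proof. by rewrite norm2_sqr; apply: eq_bigr => i _; rewrite mxE mul1r. Qed.

Lemma norm2D u v : norm2 (u + v) <= norm2 u + norm2 v.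
Proof.
have one_gt0 (i : 'I_n) : 0 < (const_mx 1 : 'cV[R]_n) i 0 by rewrite mxE.
have := ip_cauchy_schwarz _ _ _ one_gt0 u v.
rewrite !ip1_norm2 -exprMn => cs.
have {}cs : ip (const_mx 1) u v <= norm2 u * norm2 v.
  apply: le_trans (ler_norm _) _; rewrite -ler_sqr ?nnegrE ?mulr_ge0 ?norm2_ge0//.
  by rewrite real_normK ?num_real.
rewrite -ler_sqr ?nnegrE ?addr_ge0 ?norm2_ge0// -ip1_norm2 !(ipDl, ipDr).
rewrite (ipC _ _ _ v) !ip1_norm2; nra.
Qed.

Lemma norm2Z_le (a : R) v : 0 <= a <= 1 -> norm2 (a *: v) <= norm2 v.
Proof.
move=> /andP[a0 a1]; rewrite /norm2 ler_wsqrtr//; apply: ler_sum => i _.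
rewrite mxE exprMn ler_piMl ?sqr_ge0//; nra.
Qed.

Lemma norm2N v : norm2 (- v) = norm2 v.
Proof. by congr Num.sqrt; apply: eq_bigr => i _; rewrite mxE sqrrN. Qed.

Lemma norm2_le_sum v : norm2 v <= \sum_i `|v i 0|.
Proof.
have s0 : 0 <= \sum_i `|v i 0| by exact: sumr_ge0.
rewrite -ler_sqr ?nnegrE ?norm2_ge0// norm2_sqr.
(* Nonnegativity is carried through the induction to discard the cross terms. *)
suff [] : \sum_i v i 0 ^+ 2 <= (\sum_i `|v i 0|) ^+ 2 /\ 0 <= \sum_i `|v i 0| by [].
elim/big_ind2 : _ => [|a b c d [ab b0] [cd d0]|i _].
- by rewrite expr0n.
- by split; nra.
- by rewrite real_normK ?num_real.
Qed.

Lemma ip_le_norm2 w v : (forall i, 0 < w i 0) ->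
  ip w v v <= (\sum_i w i 0) * norm2 v ^+ 2.
Proof.
move=> w0; rewrite norm2_sqr mulr_sumr; apply: ler_sum => i _.
rewrite -mulrA -expr2 ler_wpM2r ?sqr_ge0// (bigD1 i)//= lerDl.
by rewrite sumr_ge0// => j _; exact: ltW.
Qed.

Lemma norm2_le_ip w : (forall i, 0 < w i 0) ->
  exists2 c, 0 < c & forall v, c * norm2 v ^+ 2 <= ip w v v.
Proof.
move=> w0.
have [c c0 cw] : exists2 c, 0 < c & forall i, i \in enum 'I_n -> c <= w i 0.
  apply: (seq_common_radius _ _ _ (fun i c => c <= w i 0)) => i _.
  by exists (w i 0) => // r /andP[].
exists c => // v; rewrite norm2_sqr mulr_sumr; apply: ler_sum => i _.
by rewrite -mulrA -expr2 ler_wpM2r ?sqr_ge0// cw// mem_enum.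
Qed.

End EuclideanNorm.

Lemma is_derive_affineB (R : realType) (f : R -> R) (t l a p r : R) :
  is_derive t 1 f l -> is_derive t 1 (fun s => p + (s - a) * r - f s) (r - l).
Proof.
move=> df.
have -> : (fun s => p + (s - a) * r - f s) = (r \*: id + cst (p - a * r)) - f.
  apply/funext => s.
  change (p + (s - a) * r - f s = r * s + (p - a * r) - f s); ring.
have := is_deriveB (is_deriveD (is_deriveZ r (is_derive_id t 1))
  (is_derive_cst (p - a * r) t 1)) df.
by move/is_derive_eq; apply; rewrite /GRing.scale/= mulr1 addr0.
Qed.

(** * Max-weight optimality and the effect of zeroing service entries *)

Section MaxWeight.
Variables (R : realType) (n : nat) (P : 'M[R]_n) (S : seq 'cV[R]_n) (w : 'cV[R]_n).
Hypothesis P_ge0 : forall i j, 0 <= P i j.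
Hypothesis S_ge0 : forall mu, mu \in S -> nonneg_vec mu.
Hypothesis S_zero : forall mu, mu \in S -> forall i, zero_entry mu i \in S.
Hypothesis w_gt0 : forall i, 0 < w i 0.
Implicit Types (x h mu nu : 'cV[R]_n).

Definition drain mu : 'cV[R]_n := (1%:M - P) *m mu.

Lemma wobj_ip x mu : wobj P w x mu = ip w x (drain mu).
Proof.
rewrite /wobj -mulmxA mxE; apply: eq_bigr => i _.
by rewrite mul_mx_diag !mxE (mulrC (w i 0)).
Qed.

(** The [j]-th coordinate of [(I - P)^T W h] with [W = diag(w)]. *)
Definition drain_coef h (j : 'I_n) : R :=
  \sum_i w i 0 * h i 0 * (1%:M - P) i j.

Lemma ip_drain h mu : ip w h (drain mu) = \sum_j drain_coef h j * mu j 0.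
Proof.
rewrite /ip; under eq_bigr => i _ do rewrite mxE mulr_sumr.
rewrite exchange_big/=; apply: eq_bigr => j _; rewrite mulr_suml.
by apply: eq_bigr => i _; rewrite mulrA.
Qed.

(** The entries of [I - P] are nonpositive off the diagonal and at most 1 on it. *)
Lemma drain_coef_le x j : nonneg_vec x -> drain_coef x j <= w j 0 * x j 0.
Proof.
move=> x0; rewrite /drain_coef (bigD1 j)//= !mxE eqxx mulrBr mulr1 -addrA gerDl.
rewrite addrC subr_le0; apply: (@le_trans _ _ 0).
  apply: sumr_le0 => i ij; rewrite !mxE (negPf ij) sub0r mulrN oppr_le0.
  by rewrite !mulr_ge0// ltW.
by rewrite !mulr_ge0// ltW.
Qed.

Definition zero_on mu (A : pred 'I_n) : 'cV[R]_n :=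
  \col_j (if A j then 0 else mu j 0).

Lemma zero_on_mem mu A : mu \in S -> zero_on mu A \in S.
Proof.
move=> muS; pose z l := foldr (fun i m => zero_entry m i) mu l.
have zS l : z l \in S by elim: l => //= i l IH; exact: S_zero.
suff <- : z (enum A) = zero_on mu A by [].
have zE l j : z l j 0 = if j \in l then 0 else mu j 0.
  elim: l => //= i l IH; rewrite mxE inE.
  by have [->|ji] := eqVneq j i; rewrite ?eqxx//= (negPf ji)/= -IH.
by apply/matrixP => j k; rewrite ord1 zE mxE mem_enum.
Qed.

Lemma ip_drain_zero_on x mu (A : pred 'I_n) : nonneg_vec x -> nonneg_vec mu ->
  ip w x (drain mu) - \sum_(j | A j) w j 0 * x j 0 * mu j 0 <=
  ip w x (drain (zero_on mu A)).
Proof.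
move=> x0 mu0; rewrite !ip_drain lerBlDr [X in _ + X]big_mkcond -big_split/=.
apply: ler_sum => j _; rewrite mxE; case: ifP => _; last by rewrite addr0.
by rewrite mulr0 add0r ler_wpM2r// drain_coef_le.
Qed.

(* [min(mu, Q)] lies between [mu] and its zeroings on [{Q < mu}], all of which
   are nearly optimal at [Q]; the worst of them for the functional [h] is
   obtained by zeroing where the coefficient of [h] is positive. *)
Lemma served_lower_bound h Qv mu : nonneg_vec Qv -> in_Sw P S w Qv mu ->
  exists2 nu, nu \in S &
    ip w h (drain nu) <= ip w h (drain (cmin mu Qv)) /\
    forall nu', nu' \in S -> ip w Qv (drain nu') <=
      ip w Qv (drain nu) + \sum_j w j 0 * mu j 0 ^+ 2.
Proof.
move=> Q0 [muS muopt]; have mu0 := S_ge0 _ muS.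
pose A := [pred j | (Qv j 0 < mu j 0) && (0 < drain_coef h j)].
exists (zero_on mu A); first exact: zero_on_mem.
split.
  rewrite !ip_drain; apply: ler_sum => j _; rewrite !mxE/=.
  have [Qmu|muQ] /= := ltP (Qv j 0) (mu j 0); last by [].
  have [h0|h0] /= := ltP 0 (drain_coef h j).
    by rewrite mulr0 mulr_ge0 ?(ltW h0) ?Q0.
  by rewrite ler_wnM2l// ltW.
move=> nu' /muopt; rewrite !wobj_ip => /le_trans; apply.
have := ip_drain_zero_on Qv mu A Q0 mu0.
suff : \sum_(j | A j) w j 0 * Qv j 0 * mu j 0 <= \sum_j w j 0 * mu j 0 ^+ 2 by lra.
rewrite big_mkcond/=; apply: ler_sum => j _; case: ifP => [/andP[Qmu _]|_].
  by rewrite -mulrA ler_wpM2l ?(ltW (w_gt0 j))// expr2 ler_wpM2r ?mu0 ?(ltW Qmu).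
by rewrite mulr_ge0 ?sqr_ge0// ltW.
Qed.

Lemma zero_on_optimal x mu (A : pred 'I_n) : nonneg_vec x ->
  (forall j, A j -> x j 0 = 0) -> in_Sw P S w x mu ->
  forall nu, nu \in S -> ip w x (drain nu) <= ip w x (drain (zero_on mu A)).
Proof.
move=> x0 xA [muS muopt] nu /muopt; rewrite !wobj_ip => /le_trans; apply.
have := ip_drain_zero_on x mu A x0 (S_ge0 _ muS).
by rewrite big1 ?subr0// => j /xA ->; rewrite mulr0 mul0r.
Qed.

(** Counterpart of [served_lower_bound]: [y] lives on the empty queues, so the effective service
    lies between the average and its zeroing there. Zeroing the empty queues whose coefficient for
    [h] is nonpositive gives an upper bound. *)
Lemma fluid_upper_bound h x (s : 'cV[R]_n -> R) (y : 'cV[R]_n) (A : pred 'I_n) :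
  (forall j, A j = (x j 0 == 0) && (drain_coef h j <= 0)) ->
  nonneg_vec x -> nonneg_vec y ->
  (forall j, y j 0 <= (\sum_(mu <- undup S) s mu *: mu) j 0) ->
  (forall j, 0 < x j 0 -> y j 0 = 0) ->
  ip w h (drain (\sum_(mu <- undup S) s mu *: mu - y)) <=
  \sum_(mu <- undup S) s mu * ip w h (drain (zero_on mu A)).
Proof.
move=> AE x0 y0 ys xy; rewrite ip_drain.
under [X in _ <= X]eq_bigr => mu _ do rewrite ip_drain mulr_sumr.
rewrite exchange_big/=; apply: ler_sum => j _.
have smuE : (\sum_(mu <- undup S) s mu *: mu) j 0 = \sum_(mu <- undup S) s mu * mu j 0.
  by rewrite summxE; apply: eq_bigr => mu _; rewrite mxE.
rewrite !mxE smuE; move: (ys j); rewrite smuE => ysj.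
under [X in _ <= X]eq_bigr => mu _ do rewrite mxE mulrCA.
have [Aj|Aj] := boolP (A j).
  rewrite [X in _ <= X]big1; last by move=> mu _; rewrite !mulr0.
  move: Aj; rewrite AE => /andP[_ hj].
  by rewrite mulr_le0_ge0// subr_ge0.
rewrite -mulr_sumr mulrBr lerBlDr lerDl.
move: Aj; rewrite AE negb_and -ltNge => /orP[xj|hj]; last by rewrite mulr_ge0// ltW.
by rewrite xy ?mulr0// lt_def xj x0.
Qed.

(** The fluid side reduces to zeroings [mu'] optimal at [x], the queue side to one [nu] nearly
    optimal at [Qv]. Adding the two optimality inequalities gives [ip w (drain nu - drain mu') (z -
    x) >= - e], where [e] absorbs the optimality gap and the shift from [Qv] to [z]. The first
    hypothesis, which active pieces supply for the projected difference [h], then orders the two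
    sides. *)
Lemma drift_comparison (e : R) h x z Qv mu0 (s : 'cV[R]_n -> R) (y : 'cV[R]_n) :
  (forall mu nu, mu \in S -> nu \in S ->
    - e <= ip w (drain mu - drain nu) (z - x) ->
    0 <= ip w h (drain mu - drain nu)) ->
  nonneg_vec x -> nonneg_vec Qv -> in_Sw P S w Qv mu0 ->
  (forall mu nu, mu \in S -> nu \in S ->
    \sum_j w j 0 * mu0 j 0 ^+ 2 + ip w (drain nu - drain mu) (z - Qv) <= e) ->
  nonneg_vec y -> (forall mu, 0 <= s mu) ->
  \sum_(mu <- undup S) s mu = 1 ->
  (forall j, y j 0 <= (\sum_(mu <- undup S) s mu *: mu) j 0) ->
  (forall j, 0 < x j 0 -> y j 0 = 0) ->
  (forall mu, mu \in S -> ~ in_Sw P S w x mu -> s mu = 0) ->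
  ip w h (drain (\sum_(mu <- undup S) s mu *: mu - y)) <=
  ip w h (drain (cmin mu0 Qv)).
Proof.
move=> mono x0 Q0 opt0 close y0 s0 s1 ys xy sx.
have [nu nuS [nuh nuopt]] := served_lower_bound h _ _ Q0 opt0.
pose A := [pred j | (x j 0 == 0) && (drain_coef h j <= 0)].
apply: le_trans nuh.
apply: le_trans (fluid_upper_bound h x s y A _ x0 y0 ys xy) _ => //.
rewrite -[X in _ <= X]mul1r -s1 mulr_suml big_seq [X in _ <= X]big_seq.
apply: ler_sum => mu; rewrite mem_undup => muS.
have [opt|nopt] := pselect (in_Sw P S w x mu); last by rewrite (sx mu) ?mul0r.
rewrite ler_wpM2l// -subr_ge0 -ipBr.
have zS : zero_on mu A \in S by exact: zero_on_mem.
apply: mono => //.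
have xz : ip w x (drain nu) <= ip w x (drain (zero_on mu A)).
  by apply: zero_on_optimal => // j /andP[/eqP].
have Qz := nuopt _ zS; have := close _ _ nuS zS.
move: xz Qz; rewrite !(ipC _ _ _ x) !(ipC _ _ _ Qv) !(ipBl, ipBr); lra.
Qed.

Lemma wmw_process_ge0 A Q : (forall t, nonneg_vec (A t)) ->
  wmw_process P S w A Q -> forall t, nonneg_vec (Q t).
Proof.
move=> A0 [Q0 [mu muP]]; elim=> // t IH i; have [[muS _] ->] := muP t.
have c0 j : 0 <= cmin (mu t) (Q t) j 0 by rewrite mxE le_min IH S_ge0.
rewrite mulmxBl mul1mx !mxE.
have : 0 <= \sum_j P i j * cmin (mu t) (Q t) j 0.
  by apply: sumr_ge0 => j _; rewrite mulr_ge0.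
have : Num.min (mu t i 0) (Q t i 0) <= Q t i 0 by rewrite ge_min lexx orbT.
by have := A0 t i; lra.
Qed.

(** The entries of [cmin mu Qv] lie between 0 and those of [mu], so the bound is uniform in the
    queue length. *)
Lemma drain_cmin_bounded : exists2 K, 0 <= K & forall mu Qv,
  mu \in S -> nonneg_vec Qv -> norm2 (drain (cmin mu Qv)) <= K.
Proof.
have [K K0 KP] := seq_bounded _ _ S
  (fun mu => \sum_i \sum_j `|(1%:M - P) i j| * mu j 0).
exists K => // mu Qv muS Q0; apply: le_trans (KP mu muS).
apply: le_trans (norm2_le_sum _ _ _) _; apply: ler_sum => i _; rewrite mxE.
apply: le_trans (ler_norm_sum _ _ _) _; apply: ler_sum => j _.
rewrite normrM ler_wpM2l// mxE ger0_norm ?le_min ?Q0 ?S_ge0//.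
by rewrite ge_min lexx.
Qed.

End MaxWeight.

Arguments drain {R n} P mu.

(** Only finitely many residuals occur, so the nonzero ones stay away from 0. *)
Lemma proj_sqnorm_lower (R : realType) (n : nat) (w : 'cV[R]_n)
    (D : seq 'cV[R]_n) : (forall i, 0 < w i 0) ->
  exists2 delta, 0 < delta & forall J p, J \in uniq_seqs D -> p \in D ->
    proj w J p != 0 ->
    delta <= ip w (proj w J p) (proj w J p).
Proof.
move=> w0; pose g (Jp : seq 'cV[R]_n * 'cV[R]_n) := proj w Jp.1 Jp.2.
have [d d0 dP] : exists2 d, 0 < d & forall Jp,
    Jp \in [seq (J, p) | J <- uniq_seqs D, p <- D] ->
    g Jp != 0 -> d <= ip w (g Jp) (g Jp).
  apply: (seq_common_radius _ _ _
    (fun Jp d => g Jp != 0 -> d <= ip w (g Jp) (g Jp))) => Jp _.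
  have [->|g0] := eqVneq (g Jp) 0; first by exists 1.
  by exists (ip w (g Jp) (g Jp)) => [|r /andP[]//]; exact: ip_gt0.
exists d => // J p JD pD; apply: (dP (J, p)).
by apply/allpairsP; exists (J, p).
Qed.

(** * Monotonicity of the potential over one time slot *)

Section Sensitivity.
Variables (R : realType) (n : nat) (P : 'M[R]_n) (S : seq 'cV[R]_n) (w : 'cV[R]_n).
Hypothesis P_ge0 : forall i j, 0 <= P i j.
Hypothesis S_ge0 : forall mu, mu \in S -> nonneg_vec mu.
Hypothesis S_zero : forall mu, mu \in S -> forall i, zero_entry mu i \in S.
Hypothesis w_gt0 : forall i, 0 < w i 0.

Let D := [seq drain P mu - drain P nu | mu <- S, nu <- S].
Variables (delta M : R).
Hypothesis delta_gt0 : 0 < delta.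
Hypothesis M_ge0 : 0 <= M.
Hypothesis delta_le : forall J p, J \in uniq_seqs D -> p \in D ->
  proj w J p != 0 -> delta <= ip w (proj w J p) (proj w J p).
Hypothesis le_M : forall p, p \in D -> ip w p p <= M.

Let V e d := potential w D delta M e d.

(* Here [z] differs from the true queue [Qv] by the cumulated arrival
   fluctuation. *)
Lemma potential_slot_nonincreasing (e : R) (lam : 'cV[R]_n)
    (q : R -> 'cV[R]_n) (m : nat) (z Qv mu : 'cV[R]_n) :
  0 < e -> fluid_solution P S w lam q -> nonneg_vec Qv -> in_Sw P S w Qv mu ->
  (forall nu nu' t, nu \in S -> nu' \in S -> 0 <= t <= 1 ->
    \sum_j w j 0 * mu j 0 ^+ 2 + ip w (drain P nu' - drain P nu)
      (z + t *: (lam - drain P (cmin mu Qv)) - Qv) <= e) ->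
  V e (z + (lam - drain P (cmin mu Qv)) - q m.+1%:R) <= V e (z - q m%:R).
Proof.
move=> e0 [q0 [qac [s [y [s01 [y0 ae]]]]]] Q0 opt close.
set r := lam - drain P (cmin mu Qv).
pose d t := z + (t - m%:R) *: r - q t.
have -> : z + r - q m.+1%:R = d m.+1%:R.
  by rewrite /d (_ : m.+1%:R - m%:R = 1) ?scale1r// -natr1; ring.
have -> : z - q m%:R = d m%:R by rewrite /d subrr scale0r addr0.
have dE t i : d t i 0 = z i 0 + (t - m%:R) * r i 0 - q t i 0 by rewrite !mxE.
have m0 : 0 <= m%:R :> R by [].
apply: (@abs_cont_dini_nonincreasing _ (fun t => V e (d t))).
- by rewrite ler_nat.
- apply: abs_cont_on_potential => //; first by rewrite ler_nat.
  move=> i; have -> : (fun t => d t i 0) =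
      (fun t => z i 0 + (t - m%:R) * r i 0 - q t i 0) by apply/funext => t.
  apply: (abs_cont_on_affineB _ (fun t => q t i 0)).
  by apply: abs_cont_onS (qac i m.+1%:R _).
apply: negligibleS ae => t /=; apply: contra_not => tP /andP[mt tm].
have t0 : 0 <= t by apply: le_trans mt.
have [dq [s1 [ys [qy sq]]]] := tP t0.
set smu := \sum_(nu <- undup S) s nu t *: nu in dq ys.
(* The arrival rate cancels in the velocity of [d], leaving the difference of the two drains. *)
apply: (dini_nonpos_potential _ _ _ _ _ _ _ _ _ _ _
  (drain P (smu - y t) - drain P (cmin mu Qv))) => //.
  move=> i; have -> : (fun t => d t i 0) =
      (fun t => z i 0 + (t - m%:R) * r i 0 - q t i 0) by apply/funext => u.
  have [_ dqi] := dq i.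
  have := is_derive_affineB _ _ _ _ m%:R (z i 0) (r i 0) dqi.
  move/is_derive_eq; apply.
  rewrite /r -(opprB 1%:M P) mulNmx -/(drain P (smu - y t)) !mxE; ring.
move=> J JD act; rewrite ipBr subr_le0.
apply: (drift_comparison _ _ _ _ _ P_ge0 S_ge0 S_zero w_gt0 e _ (q t)
  (z + (t - m%:R) *: r) _ _ (fun nu => s nu t)) => //.
- move=> nu nu' nuS nuS'.
  apply: (active_piece_monotone _ _ _ w_gt0 D _ _ delta_gt0 M_ge0 delta_le le_M) => //.
  by apply/allpairsP; exists (nu, nu').
- exact: q0.
- move=> nu nu' nuS nuS'; apply: close => //.
  by rewrite subr_ge0 mt/= lerBlDl natr1.
- exact: y0.
- by move=> nu; have /andP[] := s01 nu t t0.
Qed.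

End Sensitivity.

(** * Choice of the constants and iteration over the slots *)

Theorem theorem2 (R : realType) (n : nat) (P : 'M[R]_n) (S : seq 'cV[R]_n)
    (w : 'cV[R]_n) :
  (forall i j, 0 <= P i j) ->
  (forall mu, mu \in S -> nonneg_vec mu) ->
  (forall mu, mu \in S -> forall i, zero_entry mu i \in S) ->
  (forall i, 0 < w i 0) ->
  exists C : R,
    forall (A Q : nat -> 'cV[R]_n) (lam : 'cV[R]_n) (q : R -> 'cV[R]_n),
      (forall t, nonneg_vec (A t)) ->
      wmw_process P S w A Q ->
      nonneg_vec lam ->
      fluid_solution P S w lam q ->
      q 0 = Q 0%N ->
      forall k : nat,
        norm2 (Q k - q k%:R) <= C * (1 + norm2 lam + max_dev A lam k).
Proof.
move=> P_ge0 S_ge0 S_zero w_gt0.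
set D : seq 'cV[R]_n := [seq drain P mu - drain P nu | mu <- S, nu <- S].
have [delta delta0 deltaP] := proj_sqnorm_lower _ _ w D w_gt0.
have [M M0 MP] := seq_bounded R _ D (fun p => ip w p p).
have [K1 K10 K1P] := seq_bounded R _ S (fun mu => \sum_j w j 0 * mu j 0 ^+ 2).
have [K2 K20 K2P] := drain_cmin_bounded _ _ P S S_ge0.
have [c c0 cP] := norm2_le_ip _ _ w w_gt0.
have [L L0 LP] := seq_bounded R _ (uniq_seqs D) (fun J => level delta M (size J)).
set W := \sum_i w i 0.
have W0 : 0 <= W by apply: sumr_ge0 => i _; exact: ltW.
(* Cauchy-Schwarz constant for pairing with an element of [D]: [M] bounds its weighted square, and
   [W] compares the weighted square with the Euclidean one. *)
pose Kp := Num.sqrt (M * W).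
have Kp0 : 0 <= Kp by exact: sqrtr_ge0.
have ipD p x : p \in D -> ip w p x <= Kp * norm2 x.
  move=> pD; apply: le_trans (ler_norm _) _.
  rewrite -ler_sqr ?nnegrE ?mulr_ge0 ?norm2_ge0// real_normK ?num_real//.
  apply: le_trans (ip_cauchy_schwarz _ _ _ w_gt0 _ _) _.
  rewrite exprMn sqr_sqrtr ?mulr_ge0// -mulrA.
  apply: ler_pM; rewrite ?ip_ge0 ?MP//; exact: ip_le_norm2.
(* [K1] pays for the near-optimality of the served vector, and [Kp * (1 + K2)] for the distance of
   the corrected, interpolated queue from the true one. The summand 1 keeps [e] positive. *)
pose K := 1 + K1 + Kp * (1 + K2).
(* The product bounds the difference with the arrival fluctuation removed; the final 1 pays for
   adding it back. *)
exists (Num.sqrt (L / c) * K + 1) => A Q lam q A0 wmw lam0 fluid q0 k.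
have Q_ge0 := wmw_process_ge0 _ _ _ _ _ P_ge0 S_ge0 _ _ A0 wmw.
pose U m := \sum_(tau < m) (A tau - lam).
set X := 1 + norm2 lam + max_dev A lam k.
have dev0 : 0 <= max_dev A lam k.
  by apply: (big_ind (fun x => 0 <= x)) => // [x y x0 y0|i _]; [rewrite le_max x0 | exact: norm2_ge0].
have lam2 := norm2_ge0 _ _ lam.
have UX m : (m <= k)%N -> norm2 (U m) <= max_dev A lam k.
  (* For positive [m], [U m] is the term of index [m - 1] in [max_dev]; [U 0] is an empty sum. *)
  case: m => [_|m mk].
    rewrite /U big_ord0; suff -> : norm2 (0 : 'cV[R]_n) = 0 by [].
    by rewrite /norm2 big1 ?sqrtr0// => i _; rewrite mxE expr0n.
  exact: (le_bigmax _ (fun t : 'I_k => norm2 (\sum_(tau < t.+1) (A tau - lam)))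
    (Ordinal mk)).
have X1 : 1 <= X by rewrite /X; lra.
have K1_ : 1 <= K by rewrite /K; nra.
pose e := K * X; have e0 : 0 < e by rewrite /e; nra.
have [_ [mu muP]] := wmw.
pose V := potential w D delta M e.
have step m : (m < k)%N ->
    V (Q m.+1 - U m.+1 - q m.+1%:R) <= V (Q m - U m - q m%:R).
  move=> mk; have [opt QE] := muP m; have muS : mu m \in S by case: opt.
  have -> : Q m.+1 - U m.+1 =
      Q m - U m + (lam - drain P (cmin (mu m) (Q m))).
    rewrite QE /U big_ord_recr/= -/(U m) -(opprB 1%:M P) mulNmx.
    rewrite -/(drain P (cmin (mu m) (Q m))).
    by apply/matrixP => i j; rewrite !mxE; ring.
  apply: potential_slot_nonincreasing => // nu nu' t nuS nuS' t01.
  have pD : drain P nu' - drain P nu \in D by apply/allpairsP; exists (nu', nu).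
  apply: le_trans (lerD (K1P _ muS) (ipD _ _ pD)) _.
  set r := lam - _; have rK : norm2 r <= norm2 lam + K2.
    apply: le_trans (norm2D _ _ _ _) _; rewrite norm2N lerD2l; exact: K2P.
  have : norm2 (Q m - U m + t *: r - Q m) <= max_dev A lam k + (norm2 lam + K2).
    have -> : Q m - U m + t *: r - Q m = - U m + t *: r.
      by apply/matrixP => i j; rewrite !mxE; ring.
    apply: le_trans (norm2D _ _ _ _) _; rewrite norm2N.
    apply: lerD; first exact: UX (ltnW mk).
    by apply: le_trans rK; exact: norm2Z_le.
  move=> /(ler_wpM2l Kp0) H.
  have : Kp * (max_dev A lam k + (norm2 lam + K2)) <= Kp * ((1 + K2) * X).
    by rewrite ler_wpM2l// /X; nra.
  have : K1 <= K1 * X by rewrite ler_peMr.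
  have -> : e = X + K1 * X + Kp * ((1 + K2) * X) by rewrite /e /K; ring.
  by move: H; lra.
have Vk m : (m <= k)%N -> V (Q m - U m - q m%:R) <= L * e ^+ 2.
  elim: m => [_|m IH mk]; last exact: le_trans (step m mk) (IH (ltnW mk)).
  (* The trajectories start together, so only the constant of a piece remains, at most
     [L * e ^+ 2]. *)
  rewrite /U big_ord0 subr0 q0 subrr.
  have [J JD ->] : exists2 J, J \in uniq_seqs D & V 0 = piece w delta M e J 0.
    exact: potential_attained.
  rewrite /piece ip0r add0r ler_wpM2r ?sqr_ge0//; exact: LP.
have dk : norm2 (Q k - U k - q k%:R) <= Num.sqrt (L / c) * e.
  have rhs0 : 0 <= Num.sqrt (L / c) * e.
    by apply: mulr_ge0; [exact: sqrtr_ge0 | exact: ltW].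
  rewrite -ler_sqr ?nnegrE ?norm2_ge0//.
  have Lc : 0 <= L / c by rewrite divr_ge0// ltW.
  rewrite exprMn (sqr_sqrtr Lc) mulrAC ler_pdivlMr// mulrC; apply: le_trans (cP _) _.
  by apply: le_trans (Vk k (leqnn k)); exact: ip_le_potential.
have -> : Q k - q k%:R = (Q k - U k - q k%:R) + U k.
  by apply/matrixP => i j; rewrite !mxE; ring.
apply: le_trans (norm2D _ _ _ _) _.
have := UX k (leqnn k); rewrite mulrDl mul1r -mulrA -/e /X; lra.
Qed.
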